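(* Let $m\ge 1$, let $\|\cdot\|$ be a norm on $\mathbf{R}^m$, and let $\boldsymbol F:\mathbf{R}^m\to\mathbf{R}^m$ be a map respecting equality of real vectors, with the origin as equilibrium ($\boldsymbol F(0)=_r 0$). Assume there exist a function $V:\mathbf{R}^m\to\mathbf{R}$ and two class-$\mathcal{K}$ functions $\kappa_1,\kappa_2$ such that $$\kappa_1(\|\boldsymbol x\|)\le_r V(\boldsymbol x)\le_r\kappa_2(\|\boldsymbol x\|)\quad\text{for all }\boldsymbol x\in\mathbf{R}^m,$$ $$V(\boldsymbol x(n+1))\le_r V(\boldsymbol x(n))\quad\text{for all } n\ge 0$$ for any solution $(\boldsymbol x(n))_n$ of $\boldsymbol x^+=\boldsymbol F(\boldsymbol x)$, $\boldsymbol x(0)=\boldsymbol x_0$. Then the equilibrium is stable in the following sense: for any real $\varepsilon>0$ there exists a real $\delta>0$ such that, for every solution $(\boldsymbol x(n))_n$, $\|\boldsymbol x(0)\|\le_r\delta$ implies $\|\boldsymbol x(n)\|\le_r\varepsilon$ for all $n\ge 0$.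
   Context: The result is stated in constructive analysis (BHK interpretation). A real number $x=((a_n)_n,M)$ is a sequence of rationals with a monotone modulus $M$ from positive integers to natural numbers such that $|a_n-a_{n'}|\le 2^{-p}$ whenever $M(p)\le n,n'$. For reals $x=((a_n),M)$, $y=((b_n),N)$: $x=_r y$ means $|a_{M(p+1)}-b_{N(p+1)}|\le 2^{-p}$ for all positive integers $p$; $0\le_r x$ means $0\le a_{M(p)}+2^{-p}$ for all $p$, and $x\le_r y$ means $0\le_r y-x$; $x\in_p\mathbf{R}^+$ means $2^{-p}\le a_{M(p+1)}$, and $x<_p y$ means $y-x\in_p\mathbf{R}^+$. Strict inequality $x<y$ means $\exists p\; x<_p y$; in particular $\varepsilon>0$ means $\exists p\;0<_p\varepsilon$. $\mathbf{R}^m$ is the set of vectors of $m$ reals with componentwise equality. A solution of $\boldsymbol x^+=\boldsymbol F(\boldsymbol x)$, $\boldsymbol x(0)=\boldsymbol x_0$ is a sequence $(\boldsymbol x(n))_n$ in $\mathbf{R}^m$ with $\boldsymbol x(0)=_r\boldsymbol x_0$ and $\boldsymbol x(n+1)=_r\boldsymbol F(\boldsymbol x(n))$ for all $n$. A globally continuous function $\kappa$ is given by $h:\mathbb{Q}\times\mathbb{N}\to\mathbb{Q}$ together with, for all rational intervals $[c,d]$, monotone maps $\alpha_{c,d}$ (positive integers to naturals) and $\omega_{c,d}$ (positive integers to positive integers) such that for all rationals $a,b\in[c,d]$: $(h(a,n))_n$ is Cauchy with modulus $\alpha_{c,d}$, and $|a-b|\le 2^{-\omega_{c,d}(p)+1}$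 implies $|h(a,n)-h(b,n)|\le 2^{-p}$. Its value at a real $x=((a_n),M)$ lying in $[c,d]$ is the real $\kappa(x)$ given by the sequence $(h(a_n,n))_n$ with modulus $p\mapsto\max(\alpha_{c,d}(p+2),M(\omega_{c,d}(p+1)-1))$. A globally continuous $\kappa$ is of class-$\mathcal{K}$ if, for all reals $x,y$: (i) $x=_r0\Rightarrow\kappa(x)=_r0$; (ii) $0\le_r x$, $0\le_r y$, $x\le_r y$ imply $\kappa(x)\le_r\kappa(y)$; (iii) $0\le_r x$, $0\le_r y$, $\kappa(x)\le_r\kappa(y)$ imply $x\le_r y$; (iv) $0<x\Rightarrow 0<\kappa(x)$. *)

(* Defs.v *)
(* Everything below is intuitionistic.  Positive integers are [positive],
   rationals are [Q]; an existential statement with computational content is a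
   Sigma-type (Brouwer-Heyting-Kolmogorov reading). *)
From Stdlib Require Import ZArith QArith Qabs Qminmax Lia Lqa Arith.
From Stdlib Require Fin.

Set Implicit Arguments.
Unset Strict Implicit.
Unset Printing Implicit Defensive.

Open Scope Q_scope.

Definition pow2neg (p : positive) : Q := 1 # (2 ^ p).

Definition monotone_mod (M : positive -> nat) : Prop :=
  forall p q : positive, (p <= q)%positive -> (M p <= M q)%nat.

Definition cauchy_mod (a : nat -> Q) (M : positive -> nat) : Prop :=
  forall (p : positive) (n n' : nat), (M p <= n)%nat -> (M p <= n')%nat ->
    Qabs (a n - a n') <= pow2neg p.

Record creal : Set := CReal {
  cseq : nat -> Q;
  cmod : positive -> nat;
  cmod_mono : monotone_mod cmod;
  cseq_cauchy : cauchy_mod cseq cmod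
}.

Lemma pos_pow_add p q : (2 ^ (p + q) = 2 ^ p * 2 ^ q)%positive.
Proof.
apply Pos2Z.inj.
rewrite Pos2Z.inj_mul, !Pos2Z.inj_pow, Pos2Z.inj_add.
apply Z.pow_add_r; lia.
Qed.

Lemma pow2neg_pos p : 0 < pow2neg p.
Proof. reflexivity. Qed.

Lemma pow2neg_half p : pow2neg (p + 1) + pow2neg (p + 1) == pow2neg p.
Proof.
unfold pow2neg, Qeq; simpl.
rewrite pos_pow_add. change (2 ^ 1)%positive with 2%positive. lia.
Qed.

Lemma pow2neg_mulpow p q : pow2neg (p + q) * inject_Z (2 ^ Z.pos q) == pow2neg p.
Proof.
change (2 ^ Z.pos q)%Z with (Z.pos 2 ^ Z.pos q)%Z.
rewrite <- Pos2Z.inj_pow.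
unfold pow2neg, Qeq, inject_Z; simpl.
rewrite pos_pow_add. lia.
Qed.

Lemma cconst_mono : monotone_mod (fun _ => O).
Proof. intros p q _; apply Nat.le_refl. Qed.

Lemma cconst_cauchy (q : Q) : cauchy_mod (fun _ => q) (fun _ => O).
Proof.
intros p n n' _ _.
setoid_replace (q - q) with 0 by ring.
apply Qlt_le_weak, pow2neg_pos.
Qed.

Definition cconst (q : Q) : creal := CReal cconst_mono (@cconst_cauchy q).

Lemma copp_cauchy x : cauchy_mod (fun n => - cseq x n) (cmod x).
Proof.
intros p n n' Hn Hn'.
setoid_replace (- cseq x n - - cseq x n') with (- (cseq x n - cseq x n')) by ring.
rewrite Qabs_opp. now apply (@cseq_cauchy x).
Qed.

Definition copp (x : creal) : creal := CReal (@cmod_mono x) (@copp_cauchy x).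

Lemma cabs_cauchy x : cauchy_mod (fun n => Qabs (cseq x n)) (cmod x).
Proof.
intros p n n' Hn Hn'.
eapply Qle_trans; [ | apply (@cseq_cauchy x p n n' Hn Hn') ].
apply Qabs_Qle_condition; split.
- pose proof (Qabs_triangle_reverse (cseq x n') (cseq x n)) as H.
  rewrite (Qabs_Qminus (cseq x n') (cseq x n)) in H. lra.
- apply Qabs_triangle_reverse.
Qed.

Definition cabs (x : creal) : creal := CReal (@cmod_mono x) (@cabs_cauchy x).

Definition add_mod (M N : positive -> nat) (p : positive) : nat :=
  Nat.max (M (p + 1)%positive) (N (p + 1)%positive).

Lemma cadd_mono x y : monotone_mod (add_mod (cmod x) (cmod y)).
Proof.
intros p q Hpq; unfold add_mod.
apply Nat.max_le_compat; apply cmod_mono; lia.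
Qed.

Lemma cadd_cauchy x y :
  cauchy_mod (fun n => cseq x n + cseq y n) (add_mod (cmod x) (cmod y)).
Proof.
intros p n n' Hn Hn'; unfold add_mod in *.
setoid_replace (cseq x n + cseq y n - (cseq x n' + cseq y n'))
  with ((cseq x n - cseq x n') + (cseq y n - cseq y n')) by ring.
eapply Qle_trans; [ apply Qabs_triangle | ].
rewrite <- (pow2neg_half p).
apply Qplus_le_compat; apply cseq_cauchy; lia.
Qed.

Definition cadd (x y : creal) : creal :=
  CReal (@cadd_mono x y) (@cadd_cauchy x y).

Definition csub (x y : creal) : creal := cadd x (copp y).

(* An exponent p with |a_n| <= 2^p for all n: beyond M(1) the sequence moves by
   at most 1/2, so max (|a_n|, n <= M(1)) + 1 bounds it. *)
Fixpoint max_abs (a : nat -> Q) (N : nat) : Q :=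
  match N with
  | O => Qabs (a O)
  | S N' => Qmax (max_abs a N') (Qabs (a (S N')))
  end.

Definition bound_exp (x : creal) : positive :=
  Pos.size (Z.to_pos (Qnum (max_abs (cseq x) (cmod x 1) + 1))).

Definition bound (x : creal) : Q := inject_Z (2 ^ Z.pos (bound_exp x)).

Lemma max_abs_ge a N n : (n <= N)%nat -> Qabs (a n) <= max_abs a N.
Proof.
induction N as [|N IH]; intros Hn; simpl.
- replace n with O by lia. apply Qle_refl.
- destruct (Nat.eq_dec n (S N)) as [->|Hne].
  + apply Q.le_max_r.
  + eapply Qle_trans; [ apply IH; lia | apply Q.le_max_l ].
Qed.

Lemma Qle_pow_size (q : Q) :
  0 < q -> q <= inject_Z (2 ^ Z.pos (Pos.size (Z.to_pos (Qnum q)))).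
Proof.
destruct q as [[|k|k] d]; intros H; try discriminate H.
change (2 ^ Z.pos (Pos.size (Z.to_pos (Qnum (Z.pos k # d)))))%Z
  with (Z.pos 2 ^ Z.pos (Pos.size k))%Z.
rewrite <- Pos2Z.inj_pow.
pose proof (Pos.size_gt k).
unfold Qle, inject_Z; simpl. nia.
Qed.

Lemma bound_spec x n : Qabs (cseq x n) <= bound x.
Proof.
assert (H0 : 0 <= max_abs (cseq x) (cmod x 1)).
{ eapply Qle_trans; [ apply (Qabs_nonneg (cseq x O)) | apply max_abs_ge; lia ]. }
eapply Qle_trans; [ | apply Qle_pow_size; lra ].
destruct (Nat.le_gt_cases n (cmod x 1)) as [Hn|Hn].
- pose proof (@max_abs_ge (cseq x) _ _ Hn). lra.
- assert (H1 := @cseq_cauchy x 1%positive n (cmod x 1) ltac:(lia) ltac:(lia)).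
  assert (H2 := @max_abs_ge (cseq x) (cmod x 1) _ (Nat.le_refl _)).
  assert (H3 := Qabs_triangle_reverse (cseq x n) (cseq x (cmod x 1))).
  assert (H4 : pow2neg 1 <= 1) by discriminate.
  lra.
Qed.

Definition mul_mod (x y : creal) (p : positive) : nat :=
  Nat.max (cmod x (p + 1 + bound_exp y)%positive)
          (cmod y (p + 1 + bound_exp x)%positive).

Lemma cmul_mono x y : monotone_mod (mul_mod x y).
Proof.
intros p q Hpq; unfold mul_mod.
apply Nat.max_le_compat; apply cmod_mono; lia.
Qed.

Lemma cmul_cauchy x y :
  cauchy_mod (fun n => cseq x n * cseq y n) (mul_mod x y).
Proof.
intros p n n' Hn Hn'; unfold mul_mod in *.
setoid_replace (cseq x n * cseq y n - cseq x n' * cseq y n')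
  with ((cseq y n - cseq y n') * cseq x n + (cseq x n - cseq x n') * cseq y n')
  by ring.
eapply Qle_trans; [ apply Qabs_triangle | ].
rewrite !Qabs_Qmult, <- (pow2neg_half p).
apply Qplus_le_compat.
- rewrite <- (pow2neg_mulpow (p + 1) (bound_exp x)).
  apply Qmult_le_compat_nonneg; split; try apply Qabs_nonneg.
  + apply cseq_cauchy; lia.
  + apply bound_spec.
- rewrite <- (pow2neg_mulpow (p + 1) (bound_exp y)).
  apply Qmult_le_compat_nonneg; split; try apply Qabs_nonneg.
  + apply cseq_cauchy; lia.
  + apply bound_spec.
Qed.

Definition cmul (x y : creal) : creal :=
  CReal (@cmul_mono x y) (@cmul_cauchy x y).

Definition ceq (x y : creal) : Prop :=
  forall p : positive,
    Qabs (cseq x (cmod x (p + 1)%positive) - cseq y (cmod y (p + 1)%positive))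
      <= pow2neg p.

Definition cnonneg (x : creal) : Prop :=
  forall p : positive, 0 <= cseq x (cmod x p) + pow2neg p.

Definition cle (x y : creal) : Prop := cnonneg (csub y x).

Definition cpos_at (p : positive) (x : creal) : Prop :=
  pow2neg p <= cseq x (cmod x (p + 1)%positive).

Definition clt_at (p : positive) (x y : creal) : Prop := cpos_at p (csub y x).

Definition clt (x y : creal) : Set := { p : positive | clt_at p x y }.

Declare Scope creal_scope.
Delimit Scope creal_scope with CR.
Bind Scope creal_scope with creal.

Notation "0" := (cconst 0%Q) : creal_scope.
Infix "+" := cadd : creal_scope.
Infix "*" := cmul : creal_scope.
Infix "=r" := ceq (at level 70, no associativity) : creal_scope.
Infix "<=r" := cle (at level 70, no associativity) : creal_scope.
Infix "<r" := clt (at level 70, no associativity) : creal_scope.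

Definition vec (m : nat) : Set := Fin.t m -> creal.

Definition veq m (v w : vec m) : Prop := forall i, (v i =r w i)%CR.
Definition vzero m : vec m := fun _ => 0%CR.
Definition vadd m (v w : vec m) : vec m := fun i => (v i + w i)%CR.
Definition vscale m (a : creal) (v : vec m) : vec m := fun i => (a * v i)%CR.

Arguments vzero {m}.

Local Open Scope creal_scope.

Record is_norm m (norm : vec m -> creal) : Prop := {
  norm_ext : forall v w, veq v w -> norm v =r norm w;
  norm_nonneg : forall v, 0 <=r norm v;
  norm_eq0 : forall v, norm v =r 0 <-> veq v vzero;
  norm_scale : forall a v, norm (vscale a v) =r cabs a * norm v;
  norm_triangle : forall v w, norm (vadd v w) <=r norm v + norm w
}.

Definition respects_veq m (F : vec m -> vec m) : Prop :=
  forall v w, veq v w -> veq (F v) (F w).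

Definition is_solution m (F : vec m -> vec m) (x0 : vec m) (x : nat -> vec m)
    : Prop :=
  veq (x O) x0 /\ forall n, veq (x (S n)) (F (x n)).

Local Open Scope Q_scope.

Definition in_itv (c d a : Q) : Prop := c <= a /\ a <= d.

Record gcont : Set := GCont {
  gfun : Q -> nat -> Q;
  galpha : Q -> Q -> positive -> nat;
  gomega : Q -> Q -> positive -> positive;
  galpha_mono : forall c d, c <= d -> monotone_mod (galpha c d);
  gomega_mono : forall c d, c <= d -> forall p q : positive,
    (p <= q)%positive -> (gomega c d p <= gomega c d q)%positive;
  gfun_cauchy : forall c d, c <= d -> forall a, in_itv c d a ->
    cauchy_mod (gfun a) (galpha c d);
  gfun_cont : forall c d, c <= d -> forall a b, in_itv c d a -> in_itv c d b ->
    forall (p : positive) (n : nat),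
      Qabs (a - b) <= 2 * pow2neg (gomega c d p) ->
      Qabs (gfun a n - gfun b n) <= pow2neg p
}.

(* [Pos.pred 1 = 1]: when omega (p+1) = 1 the index omega (p+1) - 1 = 0 lies
   outside the domain of the modulus M, and M(1) is used instead. *)
Definition gmod (k : gcont) (c d : Q) (x : creal) (p : positive) : nat :=
  Nat.max (galpha k c d (p + 2)%positive)
          (cmod x (Pos.pred (gomega k c d (p + 1)%positive))).

Lemma gmod_mono k c d x : c <= d -> monotone_mod (gmod k c d x).
Proof.
intros Hcd p q Hpq; unfold gmod.
apply Nat.max_le_compat.
- apply (galpha_mono k Hcd); lia.
- apply cmod_mono.
  pose proof (@gomega_mono k c d Hcd (p + 1)%positive (q + 1)%positive ltac:(lia)).
  lia.
Qed.

Lemma pow2neg_pred w : pow2neg (Pos.pred w) <= 2 * pow2neg w.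
Proof.
destruct (Pos.eq_dec w 1) as [->|Hw].
- discriminate.
- assert (Hw' : w = (Pos.pred w + 1)%positive) by lia.
  rewrite Hw' at 2. pose proof (pow2neg_half (Pos.pred w)). lra.
Qed.

Lemma gval_cauchy k c d x : c <= d -> (forall n, in_itv c d (cseq x n)) ->
  cauchy_mod (fun n => gfun k (cseq x n) n) (gmod k c d x).
Proof.
intros Hcd Hx p n n' Hn Hn'; unfold gmod in *.
assert (H1 : Qabs (gfun k (cseq x n) n - gfun k (cseq x n') n)
             <= pow2neg (p + 1)).
{ apply (gfun_cont Hcd); auto.
  apply Qle_trans with (2 := @pow2neg_pred (gomega k c d (p + 1)%positive)).
  apply cseq_cauchy; lia. }
assert (H2 : Qabs (gfun k (cseq x n') n - gfun k (cseq x n') n')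
             <= pow2neg (p + 2)).
{ apply (gfun_cauchy Hcd); auto; lia. }
assert (H3 := Qabs_triangle (gfun k (cseq x n) n - gfun k (cseq x n') n)
                            (gfun k (cseq x n') n - gfun k (cseq x n') n')).
setoid_replace (gfun k (cseq x n) n - gfun k (cseq x n') n')
  with ((gfun k (cseq x n) n - gfun k (cseq x n') n)
        + (gfun k (cseq x n') n - gfun k (cseq x n') n')) by ring.
pose proof (pow2neg_half p).
pose proof (pow2neg_half (p + 1)) as H4.
replace (p + 1 + 1)%positive with (p + 2)%positive in H4 by lia.
pose proof (pow2neg_pos (p + 2)).
lra.
Qed.

(* The value computed in a rational interval [c,d] containing the sequence
   representing x. *)
Definition gval_in (k : gcont) (c d : Q) (x : creal) (Hcd : c <= d)
    (Hx : forall n, in_itv c d (cseq x n)) : creal :=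
  CReal (@gmod_mono k c d x Hcd) (@gval_cauchy k c d x Hcd Hx).

Lemma bound_nonneg x : - bound x <= bound x.
Proof.
pose proof (@bound_spec x O). pose proof (Qabs_nonneg (cseq x O)). lra.
Qed.

Lemma bound_itv x n : in_itv (- bound x) (bound x) (cseq x n).
Proof. apply Qabs_Qle_condition, bound_spec. Qed.

Definition gval (k : gcont) (x : creal) : creal :=
  gval_in k (@bound_nonneg x) (@bound_itv x).

(* Two moduli of the same sequence give equal reals; in particular the choice
   of the interval in [gval] is immaterial. *)
Lemma ceq_same_seq x y : (forall n, cseq x n = cseq y n) -> ceq x y.
Proof.
intros Hxy p.
set (M := cmod x (p + 1)%positive); set (N := cmod y (p + 1)%positive).
set (K := Nat.max M N).
assert (H1 := @cseq_cauchy x (p + 1)%positive M K ltac:(lia) ltac:(lia)).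
assert (H2 := @cseq_cauchy y (p + 1)%positive K N ltac:(lia) ltac:(lia)).
rewrite <- (Hxy K) in H2.
setoid_replace (cseq x M - cseq y N)
  with ((cseq x M - cseq x K) + (cseq x K - cseq y N)) by ring.
eapply Qle_trans; [ apply Qabs_triangle | ].
rewrite <- (pow2neg_half p). now apply Qplus_le_compat.
Qed.

Lemma gval_in_eq k c d x (Hcd : c <= d) (Hx : forall n, in_itv c d (cseq x n)) :
  ceq (gval_in k Hcd Hx) (gval k x).
Proof. now apply ceq_same_seq. Qed.

Coercion gval : gcont >-> Funclass.

Local Open Scope creal_scope.

(* Not a Prop: [classK_pos] transforms positivity witnesses. *)
Record is_classK (k : gcont) : Set := {
  classK_zero : forall x : creal, x =r 0 -> k x =r 0;
  classK_mono : forall x y : creal, 0 <=r x -> 0 <=r y -> x <=r y -> k x <=r k y;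
  classK_refl : forall x y : creal, 0 <=r x -> 0 <=r y -> k x <=r k y -> x <=r y;
  classK_pos : forall x : creal, 0 <r x -> 0 <r k x
}.

(* Main.v *)
(* The usual Lyapunov argument: if k2 delta <= k1 eps then
   k1 |x n| <= V (x n) <= V (x 0) <= k2 |x 0| <= k2 delta <= k1 eps, and k1 reflects the
   order.  Since k1 eps > 0 comes with a witness and k2 0 = 0, the modulus of continuity of
   k2 on [0,1] yields such a delta as an explicit power of 2. *)
Require Import Defs.
From Stdlib Require Import ZArith QArith Qabs Lia Lqa Arith.

Local Open Scope Q_scope.

(** A negative rational with denominator [d] is at most [-1/d], while [2 ^ Pos.size d] exceeds [d],
    so [p = Pos.size d] already refutes it. The case split is constructive because the order on [Q]
    is decidable. *)
Lemma nonneg_of_pow2neg (a : Q) : (forall p, - pow2neg p <= a) -> 0 <= a.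
Proof.
intros Ha. destruct (Qlt_le_dec a 0) as [Hneg|H]; [exfalso|exact H].
destruct a as [[|k|k] d]; try discriminate Hneg.
specialize (Ha (Pos.size d)). pose proof (Pos.size_gt d).
unfold Qle, Qopp, pow2neg in Ha; simpl in Ha. nia.
Qed.

Lemma cseq_near {x : creal} {p n n'} : (cmod x p <= n)%nat -> (cmod x p <= n')%nat ->
  cseq x n - pow2neg p <= cseq x n' /\ cseq x n' <= cseq x n + pow2neg p.
Proof.
intros Hn Hn'. pose proof (cseq_cauchy Hn Hn') as H.
apply Qabs_Qle_condition in H. lra.
Qed.

(** Removes the modulus from the sign condition, so that different reals can be compared at one
    common large index. *)
Lemma cnonneg_eventually (z : creal) :
  cnonneg z <->
  forall p, exists N, forall n, (N <= n)%nat -> - pow2neg p <= cseq z n.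
Proof.
split.
- intros Hz p. exists (cmod z (p + 1)%positive). intros n Hn.
  pose proof (Hz (p + 1)%positive).
  pose proof (cseq_near (Nat.le_refl _) Hn).
  pose proof (pow2neg_half p). lra.
(* A term beyond both [N] and [cmod z p] is at least [- pow2neg q] and within [pow2neg p] of the
   term tested; [q] is arbitrary. *)
- intros Hz p. apply nonneg_of_pow2neg. intros q.
  destruct (Hz q) as [N HN].
  specialize (HN _ (Nat.le_max_l N (cmod z p))).
  pose proof (cseq_near (Nat.le_refl _) (Nat.le_max_r N (cmod z p))). lra.
Qed.

Lemma cle_eventually (x y : creal) :
  cle x y <->
  forall p, exists N, forall n, (N <= n)%nat ->
    cseq x n <= cseq y n + pow2neg p.
Proof.
unfold cle. rewrite cnonneg_eventually. simpl.
split; intros H p; destruct (H p) as [N HN]; exists N; intros n Hn;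
  specialize (HN n Hn); lra.
Qed.

Lemma cle_refl (x : creal) : cle x x.
Proof.
apply cle_eventually. intros p. exists O. intros n _.
pose proof (pow2neg_pos p). lra.
Qed.

Lemma cle_trans {x y z : creal} : cle x y -> cle y z -> cle x z.
Proof.
rewrite !cle_eventually. intros Hxy Hyz p.
destruct (Hxy (p + 1)%positive) as [N HN].
destruct (Hyz (p + 1)%positive) as [N' HN'].
exists (Nat.max N N'). intros n Hn.
specialize (HN n ltac:(lia)). specialize (HN' n ltac:(lia)).
pose proof (pow2neg_half p). lra.
Qed.

Lemma ceq_cle {x y : creal} : ceq x y -> cle x y.
Proof.
intros Hxy. apply cle_eventually. intros p.
(* Error budget: 2^-(p+1) from the equality, and 2^-(p+2) for moving each of the two sequences to
   index [n]. *)
pose proof (Hxy (p + 1)%positive) as H. apply Qabs_Qle_condition in H.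
exists (Nat.max (cmod x (p + 1 + 1)%positive) (cmod y (p + 1 + 1)%positive)).
intros n Hn.
pose proof (@cseq_near x (p + 1 + 1) _ n (Nat.le_refl _) ltac:(lia)).
pose proof (@cseq_near y (p + 1 + 1) _ n (Nat.le_refl _) ltac:(lia)).
pose proof (pow2neg_half p). pose proof (pow2neg_half (p + 1)). lra.
Qed.

(** The witness bounds one term below by 2^-p; later terms differ from it by at most 2^-(p+1). *)
Lemma cpos_at_eventually {p} {x : creal} : clt_at p (cconst 0) x ->
  exists N, forall n, (N <= n)%nat -> pow2neg (p + 1) <= cseq x n.
Proof.
intros H. exists (cmod (csub x (cconst 0)) (p + 1)%positive). intros n Hn.
pose proof (cseq_near (Nat.le_refl _) Hn) as H'.
unfold clt_at, cpos_at in H. pose proof (pow2neg_half p).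
simpl in H, H'. lra.
Qed.

Lemma clt_cle (x : creal) : clt (cconst 0) x -> cle (cconst 0) x.
Proof.
intros [p Hp]. apply cle_eventually. intros q.
destruct (cpos_at_eventually Hp) as [N HN]. exists N. intros n Hn.
specialize (HN n Hn). pose proof (pow2neg_pos (p + 1)).
pose proof (pow2neg_pos q). simpl. lra.
Qed.

Lemma clt0_pow2neg p : clt (cconst 0) (cconst (pow2neg p)).
Proof. exists p. unfold clt_at, cpos_at. simpl. lra. Qed.

Lemma gcont_small_at {k : gcont} {y : creal} :
  ceq (k (cconst 0)) (cconst 0) -> clt (cconst 0) y ->
  { w : positive | cle (k (cconst (pow2neg w))) y }.
Proof.
(* Precision [p + 2] is used twice, for [k] near 0 and for [k 0 =r 0]; the sum 2^-(p+1) is the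
   eventual lower bound of [y]. The interval [0,1] can be fixed beforehand since every 2^-w lies in
   it. *)
intros Hk0 [p Hp]. exists (gomega k 0 1 (p + 2)%positive).
set (w := gomega k 0 1 (p + 2)%positive).
apply cle_eventually. intros q.
destruct (cpos_at_eventually Hp) as [N HN].
destruct (proj1 (cle_eventually _ _) (ceq_cle Hk0) (p + 2)%positive) as [N' HN'].
exists (Nat.max N N'). intros n Hn.
specialize (HN n ltac:(lia)). specialize (HN' n ltac:(lia)).
simpl in HN' |- *.
assert (Hw0 := pow2neg_pos w).
assert (Hw1 : pow2neg w <= 1) by (unfold pow2neg, Qle; simpl; lia).
assert (H01 : 0 <= 1) by discriminate.
assert (H : Qabs (gfun k (pow2neg w) n - gfun k 0 n) <= pow2neg (p + 2)).
{ apply (gfun_cont H01); try (split; lra).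
  fold w. apply Qabs_Qle_condition. lra. }
apply Qabs_Qle_condition in H.
pose proof (pow2neg_half (p + 1)) as Hh.
replace (p + 1 + 1)%positive with (p + 2)%positive in Hh by lia.
pose proof (pow2neg_pos q). lra.
Qed.

Local Open Scope creal_scope.

Theorem proposition4p19 (m : nat) (hm : (1 <= m)%nat)
  (norm : vec m -> creal) (hnorm : is_norm norm)
  (F : vec m -> vec m) (hF : respects_veq F) (hF0 : veq (F vzero) vzero)
  (V : vec m -> creal) (k1 k2 : gcont)
  (hk1 : is_classK k1) (hk2 : is_classK k2)
  (hV : forall x : vec m, k1 (norm x) <=r V x /\ V x <=r k2 (norm x))
  (hdec : forall (x0 : vec m) (x : nat -> vec m), is_solution F x0 x ->
     forall n : nat, V (x (S n)) <=r V (x n)) :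
  forall eps : creal, 0 <r eps ->
    { delta : creal &
      ((0 <r delta) *
       (forall (x0 : vec m) (x : nat -> vec m), is_solution F x0 x ->
          norm (x O) <=r delta -> forall n : nat, norm (x n) <=r eps))%type }.
Proof.
intros eps Heps.
assert (Hk0 : k2 0 =r 0).
{ apply (classK_zero hk2). now apply ceq_same_seq. }
destruct (gcont_small_at Hk0 (classK_pos hk1 Heps)) as [w Hw].
exists (cconst (pow2neg w)). split; [apply clt0_pow2neg|].
intros x0 x Hx Hdelta n.
assert (HV : V (x n) <=r V (x O)).
{ induction n as [|n IH]; [apply cle_refl|].
  exact (cle_trans (hdec x0 x Hx n) IH). }
apply (classK_refl hk1); [apply (norm_nonneg hnorm)|now apply clt_cle|].
apply (cle_trans (proj1 (hV (x n)))).
apply (cle_trans HV).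
apply (cle_trans (proj2 (hV (x O)))).
(* [Hw] is the choice of delta, so it remains to compare [k2] at [norm (x O)] and at delta. *)
refine (cle_trans _ Hw).
apply (classK_mono hk2); [apply (norm_nonneg hnorm)| |exact Hdelta].
apply clt_cle, clt0_pow2neg.
Qed.
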